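(* Let $\ell$ be an odd prime. Suppose that $A,C\in\mathcal{G}$ and $\operatorname{rank} A<\operatorname{rank} C$. If there exist $k\in\mathbb{Z}^{>0}$ and $B\in\mathcal{G}$ such that $A\leq B<C$, $\operatorname{rank} B=\operatorname{rank} A$, and $B_{\oplus k}=C$ (that is, $B\oplus(\mathbb{Z}/\ell)^{k}\cong C$), then for such a $B$ one has $S(A,C)=S(A,B)\cdot S(B,C)$. Otherwise (i.e. if no such $k$ and $B$ exist), $S(A,C)=0$.
   Context: Fix an odd prime $\ell$. $\mathcal{G}$ is the poset of isomorphism classes of finite abelian $\ell$-groups (a group and its isomorphism class are identified, so $=$ in $\mathcal{G}$ means isomorphic), ordered by $A\leq B$ if and only if there is an injective group homomorphism $A\hookrightarrow B$; $A<B$ means $A\leq B$ and $A\not\cong B$. For $A\in\mathcal{G}$, $\operatorname{rank} A:=\dim_{\mathbb{F}_\ell}(A/\ell A)$, and for an integer $i\geq 0$, $A_{\oplus i}:=A\oplus(\mathbb{Z}/\ell)^{i}$. For $A,C\in\mathcal{G}$, $\operatorname{sub}(A,C)$ is the number of subgroups of $C$ that are isomorphic to $A$. An $A$-chain is a finite linearly ordered subset of $\{B\in\mathcal{G}\mid B>A\}$. For an $A$-chain $\mathfrak{C}=\{A_j\}_{j=1}^i$ with $i\ge 1$ and $A<A_1<\cdots<A_i$, set $$\operatorname{sub}(\mathfrak{C}):=(-1)^i\operatorname{sub}(A,A_1)\prod_{j=1}^{i-1}\operatorname{sub}(A_j,A_{j+1}).$$ The function $S:\mathcal{G}\times\mathcal{G}\to\mathbb{Z}$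 is defined by $S(A,C)=0$ if $A\nleq C$; $S(A,C)=1$ if $A=C$; and $S(A,C)=\sum_{\mathfrak{C}}\operatorname{sub}(\mathfrak{C})$ if $A<C$, where the sum is over all $A$-chains $\mathfrak{C}$ with $\max\mathfrak{C}=C$. *)

(* Defs.v *)
From HB Require Import structures.
From mathcomp Require Import all_boot all_order all_algebra.
From mathcomp Require Import all_fingroup all_solvable.
From mathcomp Require Import generic_quotient finmap.
From mathcomp Require Import boolp classical_sets cardinality fsbigop.

Set Implicit Arguments.
Unset Strict Implicit.
Unset Printing Implicit Defensive.

Import Order.TTheory GRing.Theory Num.Theory GroupScope.
Local Open Scope quotient_scope.

(* Finite abelian l-groups are coded as subgroups of the symmetric groups 'S_n;
   by Cayley's theorem ([iso_class_surj] below) no isomorphism class is missed. *)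
Definition abl_code (l : nat) : Type :=
  {G : {n : nat & {group 'S_n}} | abelian (tagged G) && l.-group (tagged G)}.
HB.instance Definition _ (l : nat) := Choice.on (abl_code l).

Definition code_deg (l : nat) (x : abl_code l) : nat := tag (val x).
Definition code_grp (l : nat) (x : abl_code l) : {group 'S_(code_deg x)} :=
  tagged (val x).

Definition code_isog (l : nat) : rel (abl_code l) :=
  fun x y => code_grp x \isog code_grp y.

Lemma code_isog_refl l : reflexive (@code_isog l).
Proof. by move=> x; apply: isog_refl. Qed.

Lemma code_isog_sym l : symmetric (@code_isog l).
Proof. by move=> x y; apply: isog_sym. Qed.

Lemma code_isog_trans l : transitive (@code_isog l).
Proof. by move=> y x z; apply: isog_trans. Qed.

Canonical code_isog_equiv (l : nat) :=
  EquivRel (@code_isog l) (@code_isog_refl l) (@code_isog_sym l)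
    (@code_isog_trans l).

(* The set of isomorphism classes of finite abelian l-groups. *)
Definition iso_class (l : nat) : Type := {eq_quot (code_isog_equiv l)}.
HB.instance Definition _ (l : nat) :=
  EqQuotient.copy (iso_class l) {eq_quot (code_isog_equiv l)}.
HB.instance Definition _ (l : nat) := Choice.on (iso_class l).

(* A group in the class A; every notion below is invariant under isomorphism. *)
Definition deg (l : nat) (A : iso_class l) : nat := code_deg (repr A).
Definition grp (l : nat) (A : iso_class l) : {group 'S_(deg A)} :=
  code_grp (repr A).

Lemma grp_abelian l (A : iso_class l) : abelian (grp A).
Proof. by have /andP[] := valP (repr A). Qed.

Lemma grp_pgroup l (A : iso_class l) : l.-group (grp A).
Proof. by have /andP[] := valP (repr A). Qed.

Lemma iso_class_eq l (A B : iso_class l) : (A == B) = (grp A \isog grp B).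
Proof. by rewrite -[A in LHS]reprK -[B in LHS]reprK pi_eq_quot. Qed.

Section Cayley.
Variables (gT : finGroupType) (G : {group gT}).

Let trans (x : gT) (i : 'I_#|gT|) : 'I_#|gT| := enum_rank (enum_val i * x).

Let trans_inj x : injective (trans x).
Proof. by move=> i j /enum_rank_inj/mulIg/enum_val_inj. Qed.

Let cayley (x : gT) : 'S_#|gT| := perm (@trans_inj x).

Let cayleyM : {in G &, {morph cayley : x y / x * y}}.
Proof.
by move=> x y _ _; apply/permP=> i; rewrite permM !permE /trans enum_rankK mulgA.
Qed.

Lemma cayley_isog : exists H : {group 'S_#|gT|}, G \isog H.
Proof.
pose f := Morphism cayleyM.
exists (f @* G)%G; apply: sub_isog => //; apply/injmP=> x y _ _ /permP.
move/(_ (enum_rank 1)); rewrite !permE /trans enum_rankK !mul1g.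
exact: enum_rank_inj.
Qed.
End Cayley.

Lemma iso_class_surj (l : nat) (gT : finGroupType) (G : {group gT}) :
  abelian G -> l.-group G -> exists A : iso_class l, G \isog grp A.
Proof.
move=> abG lG; have [H GH] := cayley_isog G.
have PH : abelian H && l.-group H.
  by rewrite -(isog_abelian GH) abG /pgroup -(card_isog GH).
pose x : abl_code l := Sub (Tagged (fun n => {group 'S_n}) H) PH.
exists (\pi x); apply: (isog_trans GH).
suff: code_isog x (repr (\pi_(iso_class l) x)) by [].
by rewrite -(@pi_eq_quot _ _ (iso_class l)) reprK.
Qed.

Definition embeds (aT rT : finGroupType) (A : {group aT}) (B : {group rT}) : Prop :=
  exists f : {morphism A >-> rT}, 'injm f /\ f @* A \subset B.

Lemma embedsP (aT rT : finGroupType) (A : {group aT}) (B : {group rT}) :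
  embeds A B <-> exists2 H : {group rT}, H \subset B & H \isog A.
Proof.
split=> [[f [injf sfB]]|[H sHB]].
  by exists (f @* A)%G => //; rewrite isog_sym; apply: sub_isog.
by rewrite isog_sym => /isogP[f injf fA]; exists f; rewrite fA.
Qed.

Lemma embeds_card (aT rT : finGroupType) (A : {group aT}) (B : {group rT}) :
  embeds A B -> #|A| <= #|B|.
Proof. by case/embedsP=> H sHB /card_isog <-; apply: subset_leq_card. Qed.

Definition iso_le (l : nat) : rel (iso_class l) :=
  fun A B => `[< embeds (grp A) (grp B) >].

Lemma iso_le_refl l : reflexive (@iso_le l).
Proof.
by move=> A; apply/asboolP/embedsP; exists (grp A) => //; apply: isog_refl.
Qed.

Lemma iso_le_anti l : antisymmetric (@iso_le l).
Proof.
move=> A B /andP[/asboolP eAB /asboolP/embeds_card leBA].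
apply/eqP; rewrite iso_class_eq isog_sym.
have [H sHB isoHA] := (embedsP _ _).1 eAB.
suff -> : grp B = H by rewrite isoHA.
by apply/group_inj/eqP; rewrite eq_sym eqEcard sHB (card_isog isoHA).
Qed.

Lemma iso_le_trans l : transitive (@iso_le l).
Proof.
move=> B A C /asboolP/embedsP[H sHB /[1!isog_sym] isoAH] /asboolP[g [injg sgC]].
apply/asboolP/embedsP; exists (g @* H)%G.
  by apply: fintype.subset_trans sgC; apply: morphimS.
by rewrite isog_sym; apply: (isog_trans isoAH); apply: sub_isog.
Qed.

Fact iso_display : Order.disp_t. Proof. exact: (Order.Disp tt tt). Qed.

HB.instance Definition _ (l : nat) :=
  Order.Le_isPOrder.Build iso_display (iso_class l)
    (@iso_le_refl l) (@iso_le_anti l) (@iso_le_trans l).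

(* The dimension of the F_l-vector space A / l A, i.e. the base-l logarithm of
   its cardinal; the group law is multiplicative, so x ^+ l stands for l x. *)
Definition rank (l : nat) (A : iso_class l) : nat :=
  logn l #|grp A / [set x ^+ l | x in grp A]%SET|.

(* [is_oplus A i C] means that C is A_{\oplus i}, the class of A (+) (Z/l)^i.
   Recall that 'Z_l is Z/l only for l > 1. *)
Definition is_oplus (l : nat) (A : iso_class l) (i : nat) (C : iso_class l) : bool :=
  finset.setX (grp A) [set: 'rV['Z_l]_i]%SET \isog grp C.

Definition sub (l : nat) (A C : iso_class l) : nat :=
  #|[set H : {group 'S_(deg C)} | (H \subset grp C) && (H \isog grp A)]%SET|.

Definition is_chain (l : nat) (A : iso_class l) (X : {fset iso_class l}) : Prop :=
  (forall B, B \in X -> (A < B)%O) /\ {in X &, forall B D, (B >=< D)%O}.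

Definition is_max (l : nat) (C : iso_class l) (X : {fset iso_class l}) : Prop :=
  C \in X /\ forall B, B \in X -> (B <= C)%O.

(* On a chain X = {A_1 < ... < A_i}, sorting the elements gives [:: A_1; ...; A_i]
   and [pairmap (@sub l) A] gives [:: sub A A_1; sub A_1 A_2; ...]. *)
Definition sub_chain (l : nat) (A : iso_class l) (X : {fset iso_class l}) : int :=
  ((-1) ^+ #|` X|
    * \prod_(m <- pairmap (@sub l) A (sort <=%O (enum_fset X))) m%:Z)%R.

Definition chains_to (l : nat) (A C : iso_class l) : set {fset iso_class l} :=
  [set X | is_chain A X /\ is_max C X]%classic.

(* [\sum_(i \in D) F i] is a finitely supported sum, with junk value 0 when the
   support is infinite; this does not happen in the definition of S_fun below. *)
Lemma finite_chains_to l (A C : iso_class l) : finite_set (chains_to A C).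
Proof.
pose P := [fset B in [seq xget A (fun B : iso_class l => H \isog grp B) |
             H : {group 'S_(deg C)}]]%fset.
apply: (@sub_finite_set _ _ [set` fpowerset P]%classic); last exact: finite_fset.
move=> X [_ [_ maxC]] /=; rewrite fpowersetE; apply/fsubsetP=> B /maxC.
move=> /asboolP/embedsP[H _ isoHB]; rewrite inE /=; apply/mapP; exists H.
  by rewrite mem_enum.
apply/eqP; rewrite eq_sym iso_class_eq; case: xgetP => [D _ isoHD|/(_ B)//].
by apply: isog_trans isoHB; rewrite isog_sym.
Qed.

Definition S_fun (l : nat) (A C : iso_class l) : int :=
  if ~~ (A <= C)%O then 0%R
  else if A == C then 1%R
  else (\sum_(X \in chains_to A C) sub_chain A X)%R.

(* The hypotheses on (k, B), relative to A and C. *)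
Definition splits (l : nat) (A C : iso_class l) (k : nat) (B : iso_class l) : Prop :=
  [/\ 0 < k, (A <= B < C)%O, rank B = rank A & is_oplus B k C].

(* Main.v *)
(* S is the inverse of the unitriangular matrix sub.  Moebius inversion in the subgroup lattice
   of C inverts sub explicitly: S(A,C) is the sum of mu(K,C) over the subgroups K of C that are
   isomorphic to A, and mu(K,C) vanishes unless K contains Phi(C) = lC, in which case it is
   (-1)^d l^(d choose 2) with |C:K| = l^d.
   Given such a K, let E be a complement of Omega_1(K) in Omega_1(C).  Since K meets E trivially
   and contains Phi(C), E has a complement B in C containing K; it has the rank of K, and
   C = B + E with E elementary abelian.  So S(A,C) <> 0 forces C to split as in the statement.
   If C = B + (Z/l)^k and |B:A| = l^m, the subgroups of C isomorphic to B and containing K are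
   exactly the complements of E containing K, and there are l^(mk) of them.  Counting the pairs
   K <= B' in two ways gives S(A,C) = S(A,B) S(B,C), as (m+k choose 2) is
   (m choose 2) + (k choose 2) + mk. *)

From mathcomp Require Import boolp classical_sets cardinality fsbigop.
From mathcomp Require Import all_boot all_order all_algebra.
From mathcomp Require Import all_fingroup all_solvable.
From mathcomp Require Import ring finmap.
Require Import Defs.

Set Implicit Arguments.
Unset Strict Implicit.
Unset Printing Implicit Defensive.

Import Order.TTheory GRing.Theory Num.Theory GroupScope.

(** * Subgroup counts and Moebius sums in a finite abelian group *)

Section Counting.
Variables (gT : finGroupType) (l : nat).
Hypothesis l_prime : prime l.
Implicit Types (G H K L M E B : {group gT}).

(** M has prime index and is properly contained in M K, so M K has index l over M, and |K : K :&: M|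
    = |M K : M|. *)
Lemma card_cap_prime_index G M K :
  abelian G -> M \subset G -> #|G : M| = l -> K \subset G -> ~~ (K \subset M) ->
  #|K| = (l * #|K :&: M|)%N.
Proof.
move=> abG sMG iM sKG nKM.
have cMK : K \subset 'C(M) by rewrite (subset_trans sKG) // (sub_abelian_cent abG).
have sJG : M <*> K \subset G by rewrite join_subG sMG.
have sMJ : M \subset M <*> K by apply: joing_subl.
have iJ : #|M <*> K : M| = l.
  have /primeP[_ /(_ #|M <*> K : M|)] := l_prime.
  rewrite -iM -(Lagrange_index sJG sMJ) dvdn_mull // => /(_ isT)/orP[|/eqP//].
  by rewrite indexg_eq1 join_subG (negPf nKM) andbF.
by rewrite -iJ (cent_joinEr cMK) indexMg -indexgI mulnC Lagrange ?subsetIl.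
Qed.

(** If G is abelian and M has prime index in G and contains L, these are the K for which K / L is a
    complement of M / L in G / L. *)
Definition transversals G M L : {set {group gT}} :=
  [set K : {group gT} | [&& K \subset G, K :&: M == L & ~~ (K \subset M)]].

(** Double counting of the pairs (x, K) with x in K but not in M: each K provides (l - 1)|L|
    elements x, and each of the (l - 1)|M| elements x of G outside M lies in exactly one K, the
    group generated by L and x. *)
Lemma card_transversals G M L :
  abelian G -> M \subset G -> #|G : M| = l -> L \subset M ->
  (forall x, x \in G -> x ^+ l \in L) ->
  (#|transversals G M L| * #|L|)%N = #|M|.
Proof.
move=> abG sMG iM sLM powL; have l_gt1 := prime_gt1 l_prime.
have sLG := subset_trans sLM sMG.
have cardT K : K \in transversals G M L -> #|K| = (l * #|L|)%N.
  by rewrite inE => /and3P[sKG /eqP<- /(card_cap_prime_index abG sMG iM sKG)].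
have: \sum_(x in G :\: M) #|[set K in transversals G M L | x \in K]|
      = (#|transversals G M L| * (l.-1 * #|L|))%N.
  rewrite -sum_nat_const.
  under eq_bigr => x _ do rewrite -sum1_card.
  rewrite (exchange_big_dep (mem (transversals G M L))) /=; last first.
    by move=> x K _; rewrite !inE => /andP[].
  apply: eq_bigr => K TK; rewrite sum1_card.
  move: (TK); rewrite inE => /and3P[sKG /eqP KM _].
  have -> : (l.-1 * #|L| = #|K| - #|K :&: M|)%N by rewrite (cardT K) // KM -subn1 mulnBl mul1n.
  rewrite -cardsD; apply: eq_card => x; rewrite unfold_in in_setD [K \in _]in_set TK /= in_setD.
  case xM: (x \in M); rewrite /= ?andbF ?andbT //=.
  by case xK: (x \in K) => //=; rewrite ?andbF // (subsetP sKG).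
suff one x : x \in G :\: M -> #|[set K in transversals G M L | x \in K]| = 1%N.
  rewrite (eq_bigr _ one) sum1_card cardsD (setIidPr sMG) -(Lagrange sMG) iM.
  rewrite -{2}[#|M|]muln1 -mulnBr subn1 mulnCA mulnC => /eqP.
  by rewrite eqn_pmul2l -?subn1 ?subn_gt0 // => /eqP.
case/setDP=> xG xM; pose J := (L <*> <[x]>)%G.
have xJ : x \in J by rewrite (subsetP (joing_subr _ _)) ?cycle_id.
have sLJ : L \subset J by apply: joing_subl.
have sJG : J \subset G by rewrite join_subG sLG cycle_subG.
have nJM : ~~ (J \subset M) by apply: contra xM => /subsetP->.
have nLG : G \subset 'N(L) by rewrite cents_norm // (sub_abelian_cent abG).
(* J / L is generated by the image of x, which has order dividing l because x ^+ l lies in L. *)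
have iJ : #|J : L| <= l.
  rewrite -card_quotient ?(subset_trans sJG) // quotientYidl ?cycle_subG ?(subsetP nLG) //.
  rewrite quotient_cycle ?(subsetP nLG) // -orderE dvdn_leq ?prime_gt0 //.
  by rewrite order_dvdn -morphX ?(subsetP nLG) //= coset_id ?powL.
have cJ : #|J| = (l * #|J :&: M|)%N by apply: (card_cap_prime_index abG sMG iM).
have sLJM : L \subset J :&: M by rewrite subsetI sLJ.
have JM : J :&: M = L.
  apply/eqP; rewrite eq_sym eqEcard sLJM -(leq_pmul2l (prime_gt0 l_prime)) -cJ.
  by rewrite -(Lagrange sLJ) mulnC leq_mul2r iJ orbT.
have TJ : J \in transversals G M L by rewrite inE sJG JM eqxx.
apply/eqP/cards1P; exists J; apply/setP=> K; rewrite in_set in_set1.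
apply/andP/eqP=> [[TK xK]|->]; last by [].
apply/eqP; rewrite eq_sym -val_eqE eqEcard /= (cardT _ TK) (cardT _ TJ) leqnn andbT.
move: TK; rewrite inE => /and3P[_ /eqP<- _].
by rewrite join_subG subsetIl cycle_subG.
Qed.

Lemma expg_Phi G x : l.-group G -> abelian G -> x \in G -> x ^+ l \in 'Phi(G).
Proof.
move=> lG abG xG; rewrite (Phi_Mho lG abG) (MhoEabelian 1 lG abG) expn1.
by apply/imsetP; exists x.
Qed.

Definition codim G K : nat := logn l #|G : K|.

Lemma index_codim G K : l.-group G -> #|G : K| = (l ^ codim G K)%N.
Proof.
move=> lG; rewrite /codim -p_part part_pnat_id //.
by apply: pnat_dvd lG; rewrite dvdn_indexg.
Qed.

(* The value of the Moebius function of the subgroup lattice on an interval [K, G] with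
   G / K elementary abelian of rank d. *)
Definition moeb (d : nat) : int := ((-1) ^+ d * (l ^ 'C(d, 2))%:R)%R.

(** Pascal's rule for 'C(d.+1, 2). In this form, l ^ d terms [moeb d] cancel one term
    [moeb d.+1]. *)
Lemma moebS d : moeb d.+1 = (- (l ^ d)%:R * moeb d)%R.
Proof.
rewrite /moeb binS bin1 expnD natrM exprS mulN1r !mulNr; congr (- _)%R.
by rewrite mulrA mulrC.
Qed.

(* Grouping the K by their intersection L with a maximal M containing H, the summand
   K = L cancels the l ^ (codim G L).-1 summands K not contained in M. *)
Lemma sum_moeb_overgroups G H : l.-group G -> abelian G -> H \proper G ->
  (\sum_(K : {group gT} | [&& H \subset K, 'Phi(G) \subset K & K \subset G])
     moeb (codim G K) = 0)%R.
Proof.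
move=> lG abG /andP[sHG nGH].
have [eHG|[M maxM sHM]] := maximal_exists sHG; first by rewrite eHG subxx in nGH.
have iM := p_maximal_index lG maxM.
have sMG : M \subset G by case/maxgroupp/andP: maxM.
have sPM : 'Phi(G) \subset M := Phi_sub_max maxM.
rewrite (partition_big (fun K => (K :&: M)%G)
  (fun L => [&& H \subset L, 'Phi(G) \subset L & L \subset M])) /=; last first.
  by move=> K /and3P[sHK sPK sKG]; rewrite !subsetI sHK sPK sHM sPM subsetIr.
apply: big1 => L /and3P[sHL sPL sLM]; have sLG := subset_trans sLM sMG.
rewrite (bigD1 L) /=; last first.
  by rewrite sHL sPL sLG -val_eqE /= (setIidPl sLM) eqxx.
(* When K :&: M = L, the condition K <> L says that K is not contained in M; the lower bounds H and
   'Phi(G) on K are inherited from L. *)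
rewrite (eq_bigl (mem (transversals G M L))); last first.
  move=> K /=; rewrite inE -[(K :&: M)%G == L]val_eqE -[K == L]val_eqE /=; case: eqP => [KM|]; last by rewrite ?andbF.
  case sKG: (K \subset G); rewrite ?andbF //= andbT.
  have sLK : L \subset K by rewrite -KM subsetIl.
  rewrite (subset_trans sHL) // (subset_trans sPL) //=; congr (~~ _).
  by apply/eqP/idP=> [->//|/setIidPl eK]; rewrite -KM eK.
have [d dL] : exists d, codim G L = d.+1.
  exists (codim G L).-1; rewrite prednK // /codim -(Lagrange_index sMG sLM) lognM //.
  by rewrite iM logn_prime // eqxx.
have iL := index_codim L lG; rewrite dL in iL.
have dT K : K \in transversals G M L -> codim G K = d.
  rewrite inE => /and3P[sKG /eqP KM nKM].
  have := card_cap_prime_index abG sMG iM sKG nKM; rewrite KM => cK.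
  have /eqP : (l * #|G : K| = l ^ d.+1)%N.
    apply/eqP; rewrite -(eqn_pmul2l (cardG_gt0 L)) -iL Lagrange // mulnCA mulnA -cK.
    by rewrite Lagrange.
  by rewrite expnS eqn_pmul2l ?prime_gt0 // /codim => /eqP->; rewrite pfactorK.
have nT : #|transversals G M L| = (l ^ d)%N.
  have := card_transversals abG sMG iM sLM (fun x xG => subsetP sPL _ (expg_Phi lG abG xG)).
  move/eqP; rewrite -(Lagrange sLM) mulnC eqn_pmul2l ?cardG_gt0 // => /eqP->.
  apply/eqP; rewrite -(eqn_pmul2l (prime_gt0 l_prime)) -expnS -iL.
  by rewrite -(Lagrange_index sMG sLM) iM mulnC.
rewrite (eq_bigr (fun=> moeb d)); last by move=> K /dT->.
by rewrite sumr_const nT dL moebS mulNr mulr_natl addNr.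
Qed.

(** With trivial intersection, the condition on orders amounts to B E = G. *)
Definition complements G K E : {set {group gT}} :=
  [set B : {group gT} | [&& B \subset G, K \subset B, B :&: E == 1
                          & (#|B| * #|E|)%N == #|G|]].

(* Induction on m: for a maximal M containing K E, the complements of E in G lying over
   a given complement L of E in M are the [transversals G M L]. *)
Lemma card_complements m G K E :
  l.-group G -> abelian G -> K \subset G -> E \subset G -> K :&: E = 1 ->
  (forall x, x \in G -> x ^+ l \in K) -> #|G| = (#|K| * #|E| * l ^ m)%N ->
  #|complements G K E| = (#|E| ^ m)%N.
Proof.
elim: m G => [|m IHm] G lG abG sKG sEG tiKE powK.
  rewrite muln1 => oG; apply/eqP/cards1P; exists K; apply/setP=> B; rewrite !inE.
  apply/and4P/eqP=> [[_ sKB _]|->]; last by rewrite sKG subxx tiKE oG !eqxx.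
  rewrite oG eqn_pmul2r ?cardG_gt0 // => /eqP oB.
  by apply/eqP; rewrite eq_sym -val_eqE eqEcard sKB oB leqnn.
move=> oG.
have cKE : E \subset 'C(K) by rewrite (subset_trans sEG) ?(sub_abelian_cent abG).
have sJG : K <*> E \subset G by rewrite join_subG sKG.
have oJ : #|K <*> E| = (#|K| * #|E|)%N by rewrite cent_joinEr // TI_cardMg.
have l_gt0 := prime_gt0 l_prime.
have [eJG|[M maxM sJM]] := maximal_exists sJG.
  (* If K E were all of G, then l ^ m.+1 would be 1. *)
  move/eqP: oG; rewrite -eJG oJ -{1}[(_ * _)%N]muln1 eqn_pmul2l ?muln_gt0 ?cardG_gt0 //.
  by rewrite eq_sym -(expn0 l) eqn_exp2l ?prime_gt1.
have iM := p_maximal_index lG maxM.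
have sMG : M \subset G by case/maxgroupp/andP: maxM.
have [sKM sEM] : K \subset M /\ E \subset M by apply/andP; rewrite -join_subG.
have oGM : #|G| = (l * #|M|)%N by rewrite -(Lagrange sMG) iM mulnC.
have oM : #|M| = (#|K| * #|E| * l ^ m)%N.
  apply/eqP; rewrite -(eqn_pmul2l l_gt0) -oGM oG expnS mulnCA; exact/eqP.
have nBM B : B \in complements G K E -> ~~ (B \subset M).
  rewrite inE => /and4P[_ _ /eqP tiBE /eqP oBE]; apply/negP=> sBM.
  have : #|B * E| <= #|M| by rewrite subset_leq_card // mul_subG.
  rewrite TI_cardMg // oBE oGM -{2}[#|M|]mul1n leq_pmul2r ?cardG_gt0 //.
  by rewrite leqNgt prime_gt1.
have cap B : B \in complements G K E -> (B :&: M)%G \in complements M K E.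
  move=> cB; have nB := nBM B cB; move: cB; rewrite !inE.
  case/and4P=> sBG sKB /eqP tiBE /eqP oBE; rewrite subsetIr subsetI sKB sKM /=.
  rewrite -setIA (setIidPr sEM) tiBE eqxx /= -(eqn_pmul2l l_gt0) mulnA.
  by rewrite -(card_cap_prime_index abG sMG iM sBG nB) oBE oGM.
rewrite -sum1_card (partition_big (fun B => (B :&: M)%G) (mem (complements M K E))) //=.
rewrite (eq_bigr (fun=> #|E|)) ?sum_nat_const ?IHm ?expnSr ?(pgroupS sMG) ?(abelianS sMG) //.
  by move=> x xM; rewrite powK ?(subsetP sMG).
move=> L; rewrite inE => /and4P[sLM sKL /eqP tiLE /eqP oLE].
(* The fibre over L has |M| / |L| elements, which is |E| because L is a complement of E in M. *)
rewrite sum1_card -(mulKn #|E| (cardG_gt0 L)) oLE.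
rewrite -(card_transversals abG sMG iM sLM (fun x xG => subsetP sKL _ (powK x xG))).
rewrite mulnK ?cardG_gt0 //; apply: eq_card => B; rewrite unfold_in /=.
apply/andP/idP=> [[cB /eqP<-]|].
  by have := nBM _ cB; move: cB; rewrite !inE => /and4P[-> _ _ _] ->; rewrite eqxx.
rewrite inE => /and3P[sBG /eqP BM nB]; rewrite -val_eqE /= BM; split=> //.
have sLB : L \subset B by rewrite -BM subsetIl.
rewrite inE sBG (subset_trans sKL) //=.
rewrite -{1}(setIidPr sEM) setIA BM tiLE eqxx /=.
by rewrite (card_cap_prime_index abG sMG iM sBG nB) BM -mulnA oLE -oGM.
Qed.
End Counting.

(** * Cancellation of direct factors and transport along isomorphisms *)

Lemma perm_abelian_type_dprod (gT : finGroupType) (p : nat) (G H K : {group gT}) :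
  p.-group G -> abelian G -> H \x K = G ->
  perm_eq (abelian_type G) (abelian_type H ++ abelian_type K).
Proof.
move=> pG abG defG; have /mulG_sub[sHG sKG]: H * K = G by case/dprodP: defG.
have [bH defH atH] := abelian_structure (abelianS sHG abG).
have [bK defK atK] := abelian_structure (abelianS sKG abG).
(* Bases of H and K concatenate to a basis of G, and the orders in any basis without trivial
   elements give the abelian type up to permutation. *)
rewrite -atH -atK -map_cat.
apply: (abelian_type_pgroup pG); first by rewrite big_cat defH defK.
have: all [pred m | m > 1] (map order (bH ++ bK)).
  by rewrite map_cat all_cat atH atK !abelian_type_gt1.
by rewrite all_map (eq_all (@order_gt1 _)) all_predC has_pred1.
Qed.

(** As multisets, the type of H is that of G with the type of K removed. Types are sorted lists, so
    equality of multisets is enough. *)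
Lemma isog_dprod_cancel (gT rT : finGroupType) (p : nat) (G H K : {group gT})
    (G' H' K' : {group rT}) :
  p.-group G -> abelian G -> H \x K = G -> H' \x K' = G' ->
  G \isog G' -> K \isog K' -> H \isog H'.
Proof.
move=> pG abG defG defG' isoG isoK.
have pG' : p.-group G' by rewrite /pgroup -(card_isog isoG).
have abG' : abelian G' by rewrite -(isog_abelian isoG).
have /mulG_sub[sHG _]: H * K = G by case/dprodP: defG.
have /mulG_sub[sHG' _]: H' * K' = G' by case/dprodP: defG'.
rewrite eq_abelian_type_isog ?(abelianS sHG) ?(abelianS sHG') //; apply/eqP.
apply: (@sorted_eq _ geq).
- by move=> y x z lyx lzy; apply: leq_trans lyx.
- by move=> x y; rewrite andbC => /anti_leq.
- exact: abelian_type_sorted.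
- exact: abelian_type_sorted.
have := perm_abelian_type_dprod pG abG defG.
rewrite perm_sym (isog_abelian_type isoG) (isog_abelian_type isoK) => p1.
have := perm_trans p1 (perm_abelian_type_dprod pG' abG' defG').
by rewrite perm_cat2r.
Qed.

(** These are the copies of A in G at which the Moebius function of the subgroup lattice of G can be
    nonzero. *)
Definition frattini_subs (aT gT : finGroupType) (A : {group aT}) (G : {group gT}) :
    {set {group gT}} :=
  [set K : {group gT} | [&& K \subset G, 'Phi(G) \subset K & K \isog A]].

Lemma frattini_subs_isogl (aT bT gT : finGroupType) (A : {group aT}) (B : {group bT})
    (G : {group gT}) :
  A \isog B -> frattini_subs A G = frattini_subs B G.
Proof.
by move=> isoAB; apply/setP=> K; rewrite !inE (isog_transr _ isoAB).
Qed.

(** The lower bound W is left general to serve for both W = 'Phi(G) and W = 1. *)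
Lemma card_morphim_subgroups (aT gT rT : finGroupType) (A : {group aT}) (G : {group gT})
    (f : {morphism G >-> rT}) (W : {set gT}) :
  'injm f -> W \subset G ->
  #|[set K : {group gT} | [&& K \subset G, W \subset K & K \isog A]]| =
  #|[set K : {group rT} | [&& K \subset f @* G, f @* W \subset K & K \isog A]]|.
Proof.
move=> injf sWG; pose F (K : {group gT}) := (f @* K)%G.
rewrite -(card_in_imset (f := F)); last first.
  move=> H K; rewrite !inE => /and3P[sHG _ _] /and3P[sKG _ _] /(congr1 val) /= eHK.
  by apply: val_inj; apply: (injm_morphim_inj injf).
apply: eq_card => L; rewrite inE; apply/imsetP/and3P.
  case=> K; rewrite inE => /and3P[sKG sWK isoKA] ->; split; rewrite ?morphimS //=.
  by rewrite -(isog_transl _ (sub_isog sKG injf)).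
case=> sLfG sWL isoLA; have eL : f @* (f @*^-1 L) = L by rewrite morphpreK.
exists (f @*^-1 L)%G; last by apply: val_inj; rewrite /= eL.
have sPG : f @*^-1 L \subset G by apply: subsetIl.
rewrite inE sPG -sub_morphim_pre //= sWL /=.
by rewrite (isog_transl _ (sub_isog sPG injf)) /= eL.
Qed.

Lemma card_frattini_subs_isogr (aT gT rT : finGroupType) (A : {group aT}) (G : {group gT})
    (H : {group rT}) :
  G \isog H -> #|frattini_subs A G| = #|frattini_subs A H|.
Proof.
case/isogP=> f injf eH; rewrite /frattini_subs (card_morphim_subgroups A injf (Phi_sub G)).
by rewrite injm_Phi // eH.
Qed.

Lemma card_Ohm1_isog (gT rT : finGroupType) (G : {group gT}) (H : {group rT}) :
  G \isog H -> #|'Ohm_1(G)| = #|'Ohm_1(H)|.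
Proof. by move=> isoGH; apply/card_isog/gFisog. Qed.

(** * Splitting off an elementary abelian direct factor *)

Section Splitting.
Variables (gT : finGroupType) (l : nat) (G : {group gT}).
Hypotheses (l_prime : prime l) (lG : l.-group G) (abG : abelian G).

(** Take E to be a complement of 'Ohm_1(K) inside the elementary abelian group 'Ohm_1(G). An element
    of order l in K :&: E would lie in 'Ohm_1(K) :&: E = 1. *)
Lemma exists_Ohm1_complement (K : {group gT}) : K \subset G -> exists E : {group gT},
  [/\ E \subset G, l.-abelem E, K :&: E = 1 & (#|'Ohm_1(K)| * #|E|)%N = #|'Ohm_1(G)|].
Proof.
move=> sKG; have abO := Ohm1_abelem lG abG.
have [E defO] := abelem_split_dprod abO (OhmS 1 sKG).
have /mulG_sub[_ sEO]: 'Ohm_1(K) * E = 'Ohm_1(G) by case/dprodP: defO.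
exists E; rewrite (abelemS sEO) // (subset_trans sEO (Ohm_sub _ _)) (dprod_card defO).
split=> //; rewrite setIC; apply: TI_Ohm1; rewrite setIC.
by case/dprodP: defO.
Qed.

Lemma complement_dprod (K E B : {group gT}) :
  E \subset G -> B \in complements G K E -> B \x E = G.
Proof.
move=> sEG; rewrite inE => /and4P[sBG _ /eqP tiBE /eqP oBE].
rewrite dprodE //; last by rewrite (subset_trans sEG) ?(sub_abelian_cent abG).
by apply/eqP; rewrite eqEcard mul_subG //= TI_cardMg // oBE.
Qed.

Lemma exists_splitting (K : {group gT}) : K \subset G -> 'Phi(G) \subset K ->
  exists B E : {group gT}, [/\ B \x E = G, K \subset B, l.-abelem E,
    #|'Ohm_1(B)| = #|'Ohm_1(K)| & (#|'Ohm_1(K)| * #|E|)%N = #|'Ohm_1(G)|].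
Proof.
move=> sKG sPK; have [E [sEG abE tiKE oE]] := exists_Ohm1_complement sKG.
have sMG : K * E \subset G by rewrite mul_subG.
have cKE : E \subset 'C(K) by rewrite (subset_trans sEG) ?(sub_abelian_cent abG).
have sJG : K <*> E \subset G by rewrite join_subG sKG.
have oG : #|G| = (#|K| * #|E| * l ^ codim l G (K <*> E))%N.
  by rewrite -index_codim // -TI_cardMg // -(cent_joinEr cKE) Lagrange.
have cB := card_complements l_prime lG abG sKG sEG tiKE
  (fun x xG => subsetP sPK _ (expg_Phi lG abG xG)) oG.
(* Existence comes from the count: the number of complements of E over K is a power of |E|, hence
   nonzero. *)
have /card_gt0P[B BP] : 0 < #|complements G K E| by rewrite cB expn_gt0 cardG_gt0.
have defG := complement_dprod sEG BP; exists B, E; split=> //.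
  by move: BP; rewrite inE => /and4P[].
apply/eqP; rewrite -(eqn_pmul2r (cardG_gt0 E)) oE -{1}(Ohm1_id abE).
by rewrite (dprod_card (Ohm_dprod 1 defG)).
Qed.

(** * Counts in a group G isomorphic to a model D = B0 x E0 *)

Variables (dT : finGroupType) (D B0 E0 : {group dT}).
Hypotheses (defD : B0 \x E0 = D) (isoDG : D \isog G) (abE0 : l.-abelem E0).

Let oG : #|G| = (#|B0| * #|E0|)%N.
Proof. by rewrite (dprod_card defD) (card_isog isoDG). Qed.

Let oOG : #|'Ohm_1(G)| = (#|'Ohm_1(B0)| * #|E0|)%N.
Proof.
rewrite -{1}(Ohm1_id abE0) (dprod_card (Ohm_dprod 1 defD)).
exact/esym/card_Ohm1_isog.
Qed.

(** Both |G| and |'Ohm_1(G)| exceed their values for B by the factor |E0|. As |'Ohm_1| |'Mho^1| is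
    the order of the group, 'Phi(B) and 'Phi(G) have the same order. *)
Lemma frattini_sub_Phi (B : {group gT}) : B \in frattini_subs B0 G -> 'Phi(B) = 'Phi(G).
Proof.
rewrite inE => /and3P[sBG sPB isoB].
have lB := pgroupS sBG lG; have abB := abelianS sBG abG.
apply/eqP; rewrite eqEcard (PhiS lG) //= -(leq_pmul2l (cardG_gt0 'Ohm_1(G))).
rewrite (Phi_Mho lG abG) (Phi_Mho lB abB) (mul_card_Ohm_Mho_abelian 1 abG).
rewrite oOG -(card_Ohm1_isog isoB) mulnAC.
by rewrite (mul_card_Ohm_Mho_abelian 1 abB) (card_isog isoB) oG.
Qed.

Lemma card_frattini_over m (K : {group gT}) :
  K \subset G -> 'Phi(G) \subset K -> #|'Ohm_1(K)| = #|'Ohm_1(B0)| ->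
  #|B0| = (#|K| * l ^ m)%N ->
  #|[set B in frattini_subs B0 G | K \subset B]| = (#|E0| ^ m)%N.
Proof.
move=> sKG sPK oOK oK; have [E [sEG abE tiKE oE]] := exists_Ohm1_complement sKG.
have oEE0 : #|E| = #|E0|.
  by apply/eqP; rewrite -(eqn_pmul2l (cardG_gt0 'Ohm_1(K))) oE oOG oOK.
rewrite -oEE0 -(card_complements l_prime lG abG sKG sEG tiKE); last first.
- by rewrite oG oK oEE0 mulnAC.
- by move=> x xG; rewrite (subsetP sPK) ?expg_Phi.
apply: eq_card => B; rewrite inE.
apply/andP/idP=> [[]|cB]; last first.
  (* B x E and B0 x E0 are isomorphic, and so are E and E0; cancellation identifies B with B0. *)
  have defG := complement_dprod sEG cB.
  move: cB; rewrite !inE => /and4P[sBG sKB _ _]; rewrite sBG sKB (subset_trans sPK) //.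
  split=> //; apply: (isog_dprod_cancel lG abG defG defD); first by rewrite isog_sym.
  by rewrite (isog_abelem_card _ abE) abE0 oEE0 eqxx.
rewrite !inE => /and3P[sBG sPB isoB] sKB; rewrite sBG sKB oEE0 oG (card_isog isoB) eqxx.
rewrite andbT /= setIC; apply/eqP/TI_Ohm1.
(* B has the same 'Ohm_1 as K, by inclusion and equal orders, so B meets E trivially because K
   does. *)
suff -> : 'Ohm_1(B) = 'Ohm_1(K).
  by apply/trivgP; rewrite -tiKE [K :&: E]setIC setIS // Ohm_sub.
apply/esym/eqP; rewrite eqEcard OhmS //= oOK.
by rewrite (card_Ohm1_isog isoB).
Qed.

(** Both sides count the pairs K <= B with K a copy of A and B a copy of B0. The right-hand side
    uses 'Phi(B) = 'Phi(G), by which the K below B are exactly [frattini_subs A B]. *)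
Lemma double_count_frattini (aT : finGroupType) (A : {group aT}) m :
  #|'Ohm_1(A)| = #|'Ohm_1(B0)| -> #|B0| = (#|A| * l ^ m)%N ->
  (#|frattini_subs A G| * #|E0| ^ m = #|frattini_subs B0 G| * #|frattini_subs A B0|)%N.
Proof.
move=> oOA oA; rewrite -!sum_nat_const.
transitivity (\sum_(K in frattini_subs A G) \sum_(B in frattini_subs B0 G | K \subset B) 1)%N.
  apply: eq_bigr => K; rewrite inE => /and3P[sKG sPK isoK].
  rewrite -(card_frattini_over (m := m) sKG sPK) ?(card_isog isoK) //.
    by rewrite -sum1_card; apply: eq_bigl => B; rewrite inE.
  by rewrite (card_Ohm1_isog isoK).
rewrite (exchange_big_dep (mem (frattini_subs B0 G))) /=; last by move=> K B _ /andP[].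
apply: eq_bigr => B BP; rewrite sum1_card.
have PB := frattini_sub_Phi BP; move: (BP); rewrite inE => /and3P[sBG sPB isoB].
rewrite -(card_frattini_subs_isogr A isoB).
apply: eq_card => K; rewrite [LHS]unfold_in sBG sPB isoB /= !inE PB.
have [sKB|_] := boolP (K \subset B); rewrite ?andbF //= andbT.
by rewrite (subset_trans sKB).
Qed.
End Splitting.

(** * Chains of isomorphism classes and inversion of [sub] *)

Section Classes.
Variable l : nat.
Implicit Types (A B C : iso_class l) (X Y : {fset iso_class l}).

Definition group_class C (K : {group 'S_(deg C)}) : iso_class l :=
  xget C (fun B => K \isog grp B).

Lemma group_classE C (K : {group 'S_(deg C)}) B :
  K \subset grp C -> (group_class K == B) = (K \isog grp B).
Proof.
move=> sKC.
have [D isoD] := iso_class_surj (abelianS sKC (grp_abelian C)) (pgroupS sKC (grp_pgroup C)).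
have isoK : K \isog grp (group_class K).
  by rewrite /group_class; case: xgetP => [F _ //|/(_ D) /=].
by rewrite iso_class_eq (isog_transl _ isoK).
Qed.

Definition down C : seq (iso_class l) :=
  undup [seq group_class K | K <- enum [pred K : {group 'S_(deg C)} | K \subset grp C]].

Lemma mem_down C B : (B \in down C) = (B <= C)%O.
Proof.
rewrite mem_undup; apply/mapP/asboolP=> [[K]|/embedsP[K sKC isoK]].
  rewrite mem_enum inE => sKC ->; apply/embedsP; exists K => //.
  by rewrite -group_classE.
exists K; first by rewrite mem_enum.
by apply/eqP; rewrite eq_sym group_classE.
Qed.

Lemma lt_card A B : (A < B)%O -> #|grp A| < #|grp B|.
Proof.
rewrite lt_neqAle => /andP[neqAB /asboolP/embedsP[K sKB isoK]].
rewrite -(card_isog isoK) proper_card // properEneq sKB andbT.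
by apply: contraNneq neqAB => eK; rewrite iso_class_eq -eK isog_sym.
Qed.

Lemma sub_isogE (gT : finGroupType) (K : {group gT}) A B : K \isog grp B ->
  sub A B = #|[set H : {group gT} | (H \subset K) && (H \isog grp A)]%SET|.
Proof.
rewrite isog_sym => /isogP[f injf eK].
have e1 (rT : finGroupType) (D : {group rT}) : (1 : {set rT}) \subset D by rewrite sub1G.
have := card_morphim_subgroups (grp A) injf (e1 _ _); rewrite morphim1 eK /sub => eqc.
transitivity #|[set H : {group 'S_(deg B)} |
                 [&& H \subset grp B, (1 : {set _}) \subset H & H \isog grp A]]%SET|.
  by apply: eq_card => H; rewrite !inE e1.
by rewrite eqc; apply: eq_card => H; rewrite !inE e1.
Qed.

Lemma sub_refl A : sub A A = 1%N.
Proof.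
apply/eqP/cards1P; exists (grp A); apply/setP=> H; rewrite !inE.
apply/andP/eqP=> [[sHA isoH]|->]; last by rewrite subxx isog_refl.
by apply/eqP; rewrite -val_eqE eqEcard sHA (card_isog isoH) leqnn.
Qed.

Lemma sub_eq0 A B : ~~ (A <= B)%O -> sub A B = 0%N.
Proof.
move=> nAB; apply: eq_card0 => H; rewrite !inE; apply: contraNF nAB.
by case/andP=> sHB isoH; apply/asboolP/embedsP; exists H.
Qed.

(* The chains counted by [S_fun B C], the empty chain standing for [S_fun C C = 1]. *)
Definition chains B C : seq {fset iso_class l} :=
  if B == C then [:: fset0%fset] else enum_fset (fset_set (chains_to B C)).

Lemma S_fun_chains B C : (B <= C)%O ->
  S_fun B C = (\sum_(Y <- chains B C) sub_chain B Y)%R.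
Proof.
move=> leBC; rewrite /S_fun leBC /chains /=; case: eqP => [_|_].
  by rewrite big_seq1 /sub_chain cardfs0 expr0 mul1r big_nil.
by rewrite fsbig_finite //; apply: finite_chains_to.
Qed.

Lemma mem_chains B C Y : (Y \in chains B C) <->
  is_chain B Y /\ (if B == C then Y = fset0%fset else is_max C Y).
Proof.
rewrite /chains; case: eqP => _.
  rewrite inE; split=> [/eqP->|[_ ->//]]; split=> //.
have -> : (Y \in enum_fset (fset_set (chains_to B C))) = (Y \in fset_set (chains_to B C)) by [].
rewrite in_fset_set; last exact: finite_chains_to.
by rewrite in_setE.
Qed.

Lemma uniq_chains B C : uniq (chains B C).
Proof. by rewrite /chains; case: eqP => // _; apply: fset_uniq. Qed.

Lemma is_chain_cons A B X : (A < B)%O -> is_chain B X -> is_chain A (B |` X)%fset.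
Proof.
move=> ltAB [ltBX cX]; split=> [D|D F]; rewrite !inE.
  by case/orP=> [/eqP->//|/ltBX]; apply: (lt_trans ltAB).
case/orP=> [/eqP->|XD] /orP[/eqP->|XF]; rewrite ?comparablexx //.
- by rewrite /Order.comparable (ltW (ltBX _ XF)) ?orbT.
- by rewrite /Order.comparable (ltW (ltBX _ XD)) ?orbT.
- exact: cX.
Qed.

Lemma sorted_chain A X : is_chain A X -> sorted <=%O (sort <=%O (enum_fset X)).
Proof.
move=> [_ cX]; apply: (@sort_sorted_in _ (mem X)); last exact/allP.
by move=> B D XB XD; have := cX B D XB XD.
Qed.

Lemma chain_min A X : is_chain A X -> X != fset0%fset ->
  exists2 B, B \in X & is_chain B (X `\ B)%fset.
Proof.
move=> cX; have := sorted_chain cX; have := mem_sort <=%O (enum_fset X).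
case: (sort _ _) => [|B s] memX srtX ntX.
  by case/fset0Pn: ntX => D XD; have := memX D; rewrite XD.
have XB : B \in X by have := memX B; rewrite inE eqxx => /esym.
exists B => //; split=> [D|D F]; rewrite !inE.
  case/andP=> neqDB XD; rewrite lt_neqAle eq_sym neqDB /=.
  have := memX D; rewrite XD inE (negPf neqDB) /= => sD.
  by have /allP/(_ D sD) := order_path_min le_trans srtX.
by case/andP=> _ XD /andP[_ XF]; apply: cX.2.
Qed.

(** B lies strictly below all of X, so sorting puts it first: one more factor and one more sign. *)
Lemma sub_chain_cons A B X : is_chain B X ->
  sub_chain A (B |` X)%fset = (- (sub A B)%:Z * sub_chain B X)%R.
Proof.
move=> cX; have nXB : B \notin X by apply/negP=> /cX.1; rewrite ltxx.
have eqs : sort <=%O (enum_fset (B |` X)%fset) = B :: sort <=%O (enum_fset X).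
  apply: le_sorted_eq.
  - apply: (@sort_sorted_in _ (mem (B |` X)%fset)); last exact/allP.
    move=> D F; rewrite !inE => /orP[/eqP->|XD] /orP[/eqP->|XF]; rewrite ?lexx //.
    + by rewrite (ltW (cX.1 _ XF)).
    + by rewrite (ltW (cX.1 _ XD)) orbT.
    + exact: cX.2.
  - rewrite /= path_min_sorted ?(sorted_chain cX) //.
    by apply/allP=> D; rewrite mem_sort => /cX.1/ltW.
  - apply: uniq_perm.
    + by rewrite sort_uniq fset_uniq.
    + by rewrite /= mem_sort nXB sort_uniq fset_uniq.
    + by move=> D; rewrite mem_sort in_cons mem_sort; apply: in_fset1U.
rewrite /sub_chain eqs cardfsU1 nXB /= big_cons exprS mulN1r !mulNr; congr (- _)%R.
by rewrite mulrCA.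
Qed.

(** An A-chain ending at C is the same as its least element B together with a B-chain ending at C,
    empty when B = C. *)
Lemma S_fun_rec A C : (A < C)%O ->
  S_fun A C = (- \sum_(B <- down C | (A < B)%O) (sub A B)%:Z * S_fun B C)%R.
Proof.
move=> ltAC; rewrite S_fun_chains ?ltW // -sumrN.
have -> : (\sum_(B <- down C | (A < B)%O) - ((sub A B)%:Z * S_fun B C)
  = \sum_(B <- [seq B <- down C | (A < B)%O]) \sum_(Y <- chains B C)
      sub_chain A (B |` Y)%fset)%R.
  rewrite big_filter big_seq_cond [RHS]big_seq_cond.
  apply: eq_bigr => B /andP[]; rewrite mem_down => leBC ltAB.
  rewrite S_fun_chains // -mulNr mulr_sumr big_seq [RHS]big_seq.
  by apply: eq_bigr => Y /mem_chains[cY _]; rewrite sub_chain_cons.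
rewrite -(@big_allpairs_dep _ _ _ _ (fun _ => {fset iso_class l}) _
  (fun B Y => (B |` Y)%fset) _ (fun B => chains B C) (sub_chain A)).
apply: perm_big; apply: uniq_perm; first exact: uniq_chains.
  apply: (@allpairs_uniq_dep _ (fun _ => {fset iso_class l})).
  - by rewrite filter_uniq // undup_uniq.
  - by move=> B _; apply: uniq_chains.
  move=> p q /allpairsPdep[B [Y [_ /mem_chains[cY _] ->]]].
  move=> /allpairsPdep[D [Z [_ /mem_chains[cZ _] ->]]] /= eqBD.
  have : B \in (D |` Z)%fset by rewrite -eqBD fset1U1.
  have : D \in (B |` Y)%fset by rewrite eqBD fset1U1.
  have nYB : B \notin Y by apply/negP=> /cY.1; rewrite ltxx.
  have nZD : D \notin Z by apply/negP=> /cZ.1; rewrite ltxx.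
  have le1 (F : iso_class l) W : is_chain F W -> forall G, G \in (F |` W)%fset -> (F <= G)%O.
    by move=> cW G; rewrite !inE => /orP[/eqP->//|/cW.1/ltW].
  move=> /(le1 _ _ cY) leBD /(le1 _ _ cZ) leDB.
  (* B and D are least elements of the same chain, hence equal; removing them recovers the tails. *)
  have eBD : B = D by apply/eqP; rewrite eq_le leBD.
  move: eqBD nZD cZ leBD leDB; rewrite -{}eBD => eqBD nZB _ _ _.
  by rewrite -(fsetU1K nYB) eqBD fsetU1K.
move=> X; apply/idP/allpairsPdep=> [/mem_chains[cX]|].
  rewrite lt_eqF // => -[XC maxC].
  have [|B XB cB] := chain_min cX; first by apply/fset0Pn; exists C.
  exists B, (X `\ B)%fset; rewrite mem_filter mem_down maxC // cX.1 // fsetD1K //.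
  (* If the least element is already C, no element of X lies above it and the tail is empty. *)
  split=> //; apply/mem_chains; split=> //; case: eqP => [eBC|/eqP neBC].
    apply/fsetP=> D; rewrite in_fset0; apply/negP=> XD; have ltBD := cB.1 _ XD.
    by move: XD; rewrite inE => /andP[_ /maxC]; rewrite -eBC => /le_gtF; rewrite ltBD.
  split=> [|D]; first by rewrite !inE eq_sym neBC.
  by rewrite inE => /andP[_ /maxC].
case=> B [Y []]; rewrite mem_filter mem_down => /andP[ltAB leBC] /mem_chains[cY maxY] ->.
apply/mem_chains; split; first exact: is_chain_cons.
rewrite lt_eqF //; move: maxY; case: eqP => [<- -> | _ [YC maxC]].
  by split=> [|D]; rewrite !inE ?eqxx // orbF => /eqP->.
by split=> [|D]; rewrite !inE ?YC ?orbT // => /orP[/eqP->//|/maxC].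
Qed.

Hypothesis l_prime : prime l.

Definition frattini_sum A C : int :=
  (\sum_(K in frattini_subs (grp A) (grp C)) moeb l (codim l (grp C) K))%R.

(** The sum runs over pairs H <= K <= C with H a copy of A. For fixed H, which is proper in C as A
    and C differ, the sum over K vanishes by [sum_moeb_overgroups]. *)
Lemma sum_sub_frattini A C : A != C ->
  (\sum_(B <- down C) (sub A B)%:Z * frattini_sum B C = 0)%R.
Proof.
move=> neqAC; set mu := fun K : {group 'S_(deg C)} => moeb l (codim l (grp C) K).
pose P := [pred K : {group 'S_(deg C)} | ('Phi(grp C) \subset K) && (K \subset grp C)].
transitivity (\sum_(K | P K) \sum_(B <- down C | B == group_class K) (sub A B)%:Z * mu K)%R.
  rewrite (exchange_big_dep predT) //=; apply: eq_bigr => B _.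
  rewrite mulr_sumr; apply: eq_bigl => K; rewrite !inE.
  case sKC: (K \subset grp C); rewrite ?andbF //= andbT.
  by rewrite [B == _]eq_sym group_classE.
transitivity (\sum_(K | P K) \sum_(H : {group 'S_(deg C)} | (H \subset K) && (H \isog grp A)) mu K)%R.
  apply: eq_bigr => K /andP[_ sKC]; rewrite sumr_const.
  have isoK : K \isog grp (group_class K) by rewrite -group_classE.
  rewrite -big_filter filter_pred1_uniq ?undup_uniq //; last first.
    by rewrite mem_down; apply/asboolP/embedsP; exists K.
  by rewrite big_seq1 (sub_isogE A isoK) -natz mulr_natl cardsE.
rewrite (exchange_big_dep (fun H : {group 'S_(deg C)} => (H \subset grp C) && (H \isog grp A))) /=; last first.
  by move=> K H /andP[_ sKC] /andP[sHK ->]; rewrite (fintype.subset_trans sHK).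
apply: big1 => H /andP[sHC isoH].
rewrite -[RHS](sum_moeb_overgroups l_prime (H := H) (grp_pgroup C) (grp_abelian C)).
  by apply: eq_bigl => K; rewrite isoH andbT andbC.
rewrite properEneq sHC andbT; apply: contraNneq neqAC => eH.
by rewrite iso_class_eq -eH isog_sym.
Qed.

(** Both sides satisfy the same recurrence in A; the induction is on |C| - |A|. *)
Lemma S_fun_frattini A C : S_fun A C = frattini_sum A C.
Proof.
have [n] := ubnP (#|grp C| - #|grp A|); elim: n A => // n IHn A /ltnSE len.
have [leAC|nleAC] := boolP (A <= C)%O; last first.
  rewrite /S_fun nleAC /frattini_sum big1 // => K; rewrite inE => /and3P[sKC _ isoK].
  by case/negP: nleAC; apply/asboolP/embedsP; exists K.
have [<-|neqAC] := eqVneq A C.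
  rewrite /S_fun lexx eqxx /= /frattini_sum (big_pred1 (grp A)) => [|K].
    by rewrite /codim indexgg logn1 /moeb expr0 mul1r.
  rewrite inE; apply/and3P/eqP=> [[sKA _ isoK]|->].
    by apply/eqP; rewrite -val_eqE eqEcard sKA (card_isog isoK) leqnn.
  by rewrite subxx Phi_sub isog_refl.
have ltAC : (A < C)%O by rewrite lt_neqAle neqAC.
have /eqP := sum_sub_frattini neqAC.
rewrite (bigD1_seq A) ?mem_down ?undup_uniq //= sub_refl mul1r addr_eq0 => /eqP->.
rewrite S_fun_rec //; congr (- _)%R; rewrite [LHS]big_mkcond [RHS]big_mkcond /=.
rewrite big_seq [RHS]big_seq; apply: eq_bigr => B; rewrite mem_down => leBC.
rewrite lt_neqAle eq_sym; case: eqP => //= /eqP neqBA.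
(* The recurrence for [S_fun] has only the B above A; the other terms vanish with [sub A B]. *)
have [leAB|/sub_eq0->] := boolP (A <= B)%O; last by rewrite mul0r.
rewrite IHn //; have ltAB : (A < B)%O by rewrite lt_neqAle eq_sym neqBA.
apply: leq_trans len; rewrite ltn_sub2l ?lt_card //.
Qed.
End Classes.

(** * Rank, and the two cases for [S_fun] *)

Section Rank.
Variable l : nat.
Hypothesis l_prime : prime l.
Implicit Types (A B C : iso_class l).

(** Kernel and cokernel of the l-th power map have equal order. This turns conditions on ranks into
    conditions on 'Ohm_1. *)
Lemma card_Ohm1_rank A : #|'Ohm_1(grp A)| = (l ^ rank A)%N.
Proof.
have lA := grp_pgroup A; have abA := grp_abelian A.
rewrite /rank; have -> : [set x ^+ l | x in grp A]%SET = 'Mho^1(grp A).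
  by rewrite (MhoEabelian 1 lA abA) expn1.
rewrite card_quotient ?(char_norm (Mho_char 1 _)) //.
have <- : #|'Ohm_1(grp A)| = #|grp A : 'Mho^1(grp A)|.
  apply/eqP; rewrite -(eqn_pmul2r (cardG_gt0 'Mho^1(grp A))).
  by rewrite (mul_card_Ohm_Mho_abelian 1 abA) mulnC Lagrange ?Mho_sub.
by apply: card_pgroup; apply: pgroupS lA; apply: Ohm_sub.
Qed.

Lemma card_rV_Zp k : #|[set: 'rV['Z_l]_k]| = (l ^ k)%N.
Proof. by rewrite cardsT card_mx card_ord Zp_cast ?prime_gt1 // mul1n. Qed.

Lemma abelem_rV_Zp k : l.-abelem [set: 'rV['Z_l]_k].
Proof.
rewrite abelemE // FinRing.zmod_abelian; apply/exponentP=> x _.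
apply/matrixP=> i j; rewrite FinRing.zmodXgE mulmxnE -mulr_natr pchar_Zp ?prime_gt1 //.
by rewrite mulr0 FinRing.zmod1gE mxE.
Qed.

Lemma frattini_sumE A C d : #|grp C| = (#|grp A| * l ^ d)%N ->
  frattini_sum A C = (#|frattini_subs (grp A) (grp C)|%:R * moeb l d)%R.
Proof.
move=> oC; rewrite mulr_natl -sumr_const; apply: eq_bigr => K.
rewrite inE => /and3P[sKC _ isoK]; congr moeb.
rewrite /codim -divgS // oC (card_isog isoK) mulKn ?cardG_gt0 //.
by rewrite pfactorK.
Qed.

Lemma moebD m k : moeb l (m + k) = (moeb l m * moeb l k * (l ^ (m * k))%:R)%R.
Proof.
elim: m => [|m IHm].
  by rewrite add0n mul0n expn0 mulr1 [X in (X * _)%R]/moeb expr0 bin0n !mul1r.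
by rewrite addSn !moebS // IHm mulSn !expnD !natrM; ring.
Qed.

Lemma S_fun_split A C k B : splits A C k B -> S_fun A C = (S_fun A B * S_fun B C)%R.
Proof.
case=> k_gt0 /andP[leAB ltBC] rkBA oplusC.
have lC := grp_pgroup C; have abC := grp_abelian C.
set E := [set: 'rV['Z_l]_k] in oplusC.
have defD := setX_dprod (grp B) E.
have abE : l.-abelem (setX (1 : {set 'S_(deg B)}) E).
  have := abelem_rV_Zp k.
  by rewrite (isog_abelem (isog_set1X 'S_(deg B) [set: 'rV['Z_l]_k]%G)).
have isoB : grp B \isog setX (grp B) (1 : {set 'rV['Z_l]_k}) by apply: isog_setX1.
have oE : #|setX (1 : {set 'S_(deg B)}) E| = (l ^ k)%N.
  by rewrite cardsX cards1 mul1n card_rV_Zp.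
have oC : #|grp C| = (#|grp B| * l ^ k)%N.
  by rewrite -(card_isog oplusC) cardsX card_rV_Zp.
have [m oB] : exists m, #|grp B| = (#|grp A| * l ^ m)%N.
  have [K sKB isoK] := (embedsP _ _).1 (asboolW leAB).
  exists (codim l (grp B) K); rewrite -(card_isog isoK) -index_codim ?Lagrange //.
  exact: grp_pgroup.
rewrite !S_fun_frattini // (frattini_sumE oB) (frattini_sumE oC).
rewrite (frattini_sumE (d := m + k)); last by rewrite oC oB expnD mulnA.
rewrite (frattini_subs_isogl _ isoB).
have oOAB : #|'Ohm_1(grp A)| = #|'Ohm_1(setX_group (grp B) [1 'rV['Z_l]_k])|.
  by rewrite -(card_Ohm1_isog (H := setX_group (grp B) [1 'rV['Z_l]_k]) isoB) !card_Ohm1_rank rkBA.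
have oXB : #|setX_group (grp B) [1 'rV['Z_l]_k]| = (#|grp A| * l ^ m)%N.
  by rewrite -oB; apply/esym/card_isog.
have := double_count_frattini l_prime lC abC defD oplusC abE oOAB oXB.
rewrite oE -(card_frattini_subs_isogr (grp A) isoB) -expnM [(k * m)%N]mulnC.
(* The factor l ^ (m * k) from [moebD] is the |E| ^ m of the double count. *)
move=> /(congr1 (fun n => n%:R : int)%R); rewrite !natrM moebD => cnt.
by ring: cnt.
Qed.

Lemma S_fun_neq0_splits A C : rank A < rank C -> S_fun A C <> 0%R ->
  exists k B, splits A C k B.
Proof.
move=> rkAC; rewrite S_fun_frattini // /frattini_sum => S0.
have [noK|[K]] := set_0Vmem (frattini_subs (grp A) (grp C)).
  by case: S0; rewrite noK big_set0.
rewrite inE => /and3P[sKC sPK isoK].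
have lC := grp_pgroup C; have abC := grp_abelian C.
have [B [E [defC sKB abE oOB oE]]] := exists_splitting l_prime lC abC sKC sPK.
have /mulG_sub[sBC _]: B * E = grp C by case/dprodP: defC.
have [B' isoB] := iso_class_surj (abelianS sBC abC) (pgroupS sBC lC).
have oK := card_Ohm1_isog isoK; rewrite card_Ohm1_rank in oK.
have lg1 := prime_gt1 l_prime.
(* The order of E, hence the witness k, is read off from |'Ohm_1(K)| |E| = |'Ohm_1(C)|. *)
have oEk : #|E| = (l ^ (rank C - rank A))%N.
  apply/eqP; rewrite -(eqn_pmul2l (cardG_gt0 'Ohm_1(K))) oE card_Ohm1_rank oK -expnD.
  by rewrite subnKC // ltnW.
exists (rank C - rank A), B'; split.
- by rewrite subn_gt0.
- rewrite lt_neqAle; apply/and3P; split.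
  + have [f injf fB] := isogP isoB.
    apply/asboolP/embedsP; exists (f @* K)%G; first by rewrite -fB morphimS.
    by rewrite -(isog_transl _ (sub_isog sKB injf)).
  + rewrite iso_class_eq; apply/negP=> /card_isog.
    rewrite -(dprod_card defC) oEk -(card_isog isoB) -{1}[#|B|]muln1; apply/eqP.
    by rewrite eqn_pmul2l ?cardG_gt0 // eq_sym -(expn0 l) eqn_exp2l // -lt0n subn_gt0.
  + by apply/asboolP/embedsP; exists B.
- apply/eqP; rewrite -(eqn_exp2l _ _ lg1) -!card_Ohm1_rank.
  by rewrite -(card_Ohm1_isog isoB) oOB oK card_Ohm1_rank.
rewrite /is_oplus; apply: (isog_dprod (setX_dprod _ _) defC).
  by rewrite isog_sym (isog_transl _ isoB); apply: isog_setX1.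
apply: isog_trans (_ : [set: 'rV['Z_l]_(rank C - rank A)] \isog E); last first.
  by rewrite (isog_abelem_card _ (abelem_rV_Zp _)) abE oEk card_rV_Zp eqxx.
by rewrite isog_sym; apply: isog_set1X.
Qed.
End Rank.

Theorem theorem3p8 (l : nat) (l_prime : prime l) (l_odd : odd l)
    (A C : iso_class l) (rkAC : rank A < rank C) :
  (forall (k : nat) (B : iso_class l),
     splits A C k B -> S_fun A C = (S_fun A B * S_fun B C)%R)
  /\ (~ (exists (k : nat) (B : iso_class l), splits A C k B) -> S_fun A C = 0%R).
Proof.
split=> [k B|noB]; first exact: S_fun_split.
have [//|/eqP neS] := eqVneq (S_fun A C) 0%R.
by case: noB; apply: S_fun_neq0_splits.
Qed.
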